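(* Let $\mathbb{H}_3$ be the $3$-dimensional Heisenberg group with Lie algebra $\mathfrak{h}_3$, let $\{X_1,X_2,X_3\}$ be the basis of $\mathfrak{h}_3$ with $[X_1,X_2]=X_3$, $[X_1,X_3]=[X_2,X_3]=0$, and let $\{\omega_1,\omega_2,\omega_3\}$ be its dual basis. Every $\mathbb{Z}_2^2$-symmetric Lorentzian metric $g$ on $\mathbb{H}_3$ such that the (non-trivial) components of the grading of $\mathfrak{h}_3$ are non-degenerate is reduced, by an automorphism of $\mathfrak{h}_3$, to one of the two forms $$g=-\omega_1^2+\omega_2^2+\lambda^2\omega_3^2\qquad\text{or}\qquad g=\omega_1^2+\omega_2^2-\lambda^2\omega_3^2$$ with $\lambda$ a non-zero real number.
   Context: $\mathbb{H}_3$ is the group of real upper triangular unipotent $3\times 3$ matrices; left-invariant metrics on $\mathbb{H}_3$ are identified with bilinear forms on $\mathfrak{h}_3$. A Lorentzian metric on an $n$-manifold is a smooth field of non-degenerate quadratic forms of signature $(n-1,1)$. A subgroup $\Gamma\subset \mathrm{Aut}(\mathfrak{h}_3)$ isomorphic to $\mathbb{Z}_2^2=(\mathbb{Z}/2\mathbb{Z})^2$ consists of commuting involutive automorphisms, and its simultaneous eigenspace decomposition is a $\mathbb{Z}_2^2$-grading $\mathfrak{h}_3=\bigoplus_{\gamma\in\mathbb{Z}_2^2}\mathfrak{g}_\gamma$ with $[\mathfrak{g}_\gamma,\mathfrak{g}_{\gamma'}]\subset\mathfrak{g}_{\gamma\gamma'}$, where $\mathfrak{g}_\epsilon$ ($\epsilon$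 the unit of $\mathbb{Z}_2^2$) is the space of vectors fixed by $\Gamma$. A $\mathbb{Z}_2^2$-symmetric structure on $\mathbb{H}_3=\mathbb{H}_3/\{e\}$ is the structure given by such a grading (with $\mathfrak{g}_\epsilon=\{0\}$, so the isotropy subgroup $H$ is trivial). A $\mathbb{Z}_2^2$-symmetric Lorentzian metric for this structure is an $\mathbb{H}_3$-invariant (i.e. left-invariant) Lorentzian metric $g$, with associated bilinear form $B$ on $\mathfrak{h}_3$, such that one of the following holds: (1) the components $\mathfrak{g}_\gamma$, $\gamma\neq\epsilon$, are pairwise orthogonal and non-degenerate with respect to $B$; (2) one component $\mathfrak{g}_{\lambda_0}$, $\lambda_0\neq\epsilon$, is degenerate, the other components are orthogonal and non-degenerate, and there exists a component $\mathfrak{g}_{\lambda_1}$ such that the restriction of $B$ to $\mathfrak{g}_{\lambda_0}\oplus\mathfrak{g}_{\lambda_1}$ has signature $(1,1)$. *)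

(* Defs.v *)
From HB Require Import structures.
From mathcomp Require Import all_boot all_order all_algebra.
From mathcomp Require Import all_classical all_reals all_analysis.
Set Implicit Arguments.
Unset Strict Implicit.
Unset Printing Implicit Defensive.
Import Order.TTheory GRing.Theory Num.Theory.
Import numFieldNormedType.Exports.
Local Open Scope ring_scope.

Definition heisenberg (R : realType) : pred 'M[R]_3 :=
  fun p => [forall i : 'I_3, forall j : 'I_3,
    (j <= i)%N ==> (p i j == (i == j)%:R)].

Definition heisenberg_algebra (R : realType) : {vspace 'M[R]_3} :=
  <<[:: delta_mx (0 : 'I_3) (1 : 'I_3); delta_mx 1 2%:R;
        delta_mx 0 2%:R]%R>>%VS.

Notation h3 R := (subvs_of (heisenberg_algebra R)).

(* vsproj is the inverse of the inclusion vsval here, because strictly upper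
   triangular matrices are closed under the matrix product. *)
Definition bracket (R : realType) (u v : h3 R) : h3 R :=
  vsproj (heisenberg_algebra R) (vsval u *m vsval v - vsval v *m vsval u).

Definition lie_automorphism (R : realType) (f : 'End(h3 R)) : Prop :=
  bijective f /\ forall u v, f (bracket u v) = bracket (f u) (f v).

(* The group is the affine subspace 1 + h3 of the matrices, so that every
   tangent space is h3 as a space of matrices, and left translation by p has
   differential u |-> p *m u. *)
Definition left_translation (R : realType) (p : 'M[R]_3) (u : h3 R) : h3 R :=
  vsproj (heisenberg_algebra R) (p *m vsval u).

Definition heisenberg_chart (R : realType) (x : 'rV[R]_3) : 'M[R]_3 :=
  1%:M + x 0 0 *: delta_mx 0 1 + x 0 1 *: delta_mx 1 2%:R
       + x 0 2%:R *: delta_mx 0 2%:R.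

Definition smooth (R : realType) (f : 'rV[R]_3 -> R) : Prop :=
  forall (s : seq 'rV[R]_3) (x : 'rV[R]_3),
    differentiable (foldr (fun v h => fun y => 'D_v h y) f s) x.

Section Forms.
Variables (R : realType) (B : {symmetric (h3 R)}).
Implicit Types U V : {vspace h3 R}.

Definition nondegenerate_on U : Prop :=
  forall u, u \in U -> {in U, forall v, B u v = 0} -> u = 0.

Definition orthogonal_spaces U V : Prop := {in U & V, forall u v, B u v = 0}.

(* p positive and q negative directions, hence nondegenerate on U. *)
Definition has_signature_on U (p q : nat) : Prop :=
  exists2 e : (p + q).-tuple (h3 R), basis_of U e &
    forall i j : 'I_(p + q),
      B (tnth e i) (tnth e j) = if i == j then (-1) ^+ (p <= i)%N else 0.

End Forms.

(* Only the values of g at points of the group are meaningful. *)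
Definition lorentzian_metric (R : realType) (g : 'M[R]_3 -> {symmetric (h3 R)})
  : Prop :=
  (forall u v : h3 R, smooth (fun x => g (heisenberg_chart x) u v)) /\
  (forall p, heisenberg p -> has_signature_on (g p) fullv 2 1).

Definition left_invariant (R : realType) (g : 'M[R]_3 -> {symmetric (h3 R)})
  : Prop :=
  forall p q, heisenberg p -> heisenberg q -> forall u v : h3 R,
    g (p *m q) (left_translation p u) (left_translation p v) = g q u v.

(* Z_2^2, written additively: the unit epsilon is 0. *)
Notation Z22 := ('Z_2 * 'Z_2)%type.

Definition Z22_char (R : realType) (c s : Z22) : R :=
  (-1) ^+ (c.1 * s.1 + c.2 * s.2)%N.

(* sigma is an isomorphism of Z_2^2 onto the subgroup Gamma of the automorphism
   group; the components are the simultaneous eigenspaces of Gamma, indexed by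
   its characters, the dual of Z_2^2 being identified with Z_2^2 by the pairing
   Z22_char. *)
Definition Z22_symmetric_structure (R : realType) (G : Z22 -> {vspace h3 R})
  : Prop :=
  exists sigma : Z22 -> 'End(h3 R),
    [/\ forall s, lie_automorphism (sigma s),
        forall s t : Z22, sigma (s + t) = (sigma s \o sigma t)%VF,
        injective sigma,
        forall c, G c = (\bigcap_s passmx.leigenspace (sigma s) (Z22_char R c s))%VS
      & G 0 = 0%VS].

Definition Z22_symmetric_form (R : realType) (G : Z22 -> {vspace h3 R})
    (B : {symmetric (h3 R)}) : Prop :=
  ((forall c, c != 0 -> nondegenerate_on B (G c)) /\
   (forall c d, c != 0 -> d != 0 -> c != d ->
      orthogonal_spaces B (G c) (G d)))
  \/
  (exists2 l0 : Z22, l0 != 0 &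
    [/\ ~ nondegenerate_on B (G l0),
        forall c, c != 0 -> c != l0 -> nondegenerate_on B (G c),
        forall c d, c != 0 -> d != 0 -> c != l0 -> d != l0 -> c != d ->
          orthogonal_spaces B (G c) (G d)
      & exists2 l1 : Z22, l1 != l0 &
          has_signature_on B (G l0 + G l1)%VS 1 1]).

(* A left-invariant metric corresponds to its bilinear form at the identity. *)
Definition Z22_symmetric_lorentzian_metric (R : realType)
    (G : Z22 -> {vspace h3 R}) (g : 'M[R]_3 -> {symmetric (h3 R)}) : Prop :=
  [/\ lorentzian_metric g, left_invariant g & Z22_symmetric_form G (g 1%:M)].

(* Main.v *)
Require Import Defs.
From HB Require Import structures.
From mathcomp Require Import all_boot all_order all_algebra.
From mathcomp Require Import all_classical all_reals all_analysis.
From mathcomp Require Import ring lra.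
Set Implicit Arguments.
Unset Strict Implicit.
Unset Printing Implicit Defensive.
Import Order.TTheory GRing.Theory Num.Theory.
Import numFieldNormedType.Exports.
Local Open Scope ring_scope.

(** The Z_2^2-grading alone produces an adapted basis.  Averaging over Gamma
splits every vector into components, so the nonzero bracket [X_1, X_2] = X_3
forces a nonzero bracket [y, z] of homogeneous vectors, of degrees c and d
(component_pair).  Since only 0 has degree 0, the degrees c, d and c + d are
all nonzero; hence they are pairwise distinct, the group being of exponent two.

When the components are nondegenerate, the second alternative in the definition
of a Z_2^2-symmetric form is excluded, so that the components are pairwise
orthogonal for B, the bilinear form of g at the identity.  In particular y, z
and [y, z] are pairwise orthogonal.  As the centre contains [h_3, h_3], sending
X_1, X_2, X_3 to y, z, [y, z] defines an automorphism (automorphism_of_pair),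
along which B pulls back to a diagonal form.

The signature (2,1) enters through a timelike vector whose orthogonal complement
is positive definite: exactly one diagonal coefficient is then negative and the
two others are positive (diagonal_signs).  The automorphism depends only on y
and z, so that these can be rescaled independently to normalize the first two
coefficients to 1 or -1; the third is then known up to a square, which is
lambda^2 (normalized_pair_pullback).  The negative coefficient sits on y, on z
or on [y, z]; exchanging y and z reduces the second case to the first, and
the two remaining cases are the two normal forms. *)

(** * The Lie bracket as a bilinear map *)

Section Bracket.
Variable R : realType.
Implicit Types u v w : h3 R.

Fact bracket_is_bilinear : bilinear_for
  (GRing.Scale.Law.clone _ _ *:%R _) (GRing.Scale.Law.clone _ _ *:%R _)
  (@bracket R).
Proof.
have vsprojP a (A B : 'M[R]_3) :
    a *: vsproj (heisenberg_algebra R) A + vsproj (heisenberg_algebra R) B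
    = vsproj (heisenberg_algebra R) (a *: A + B) by rewrite linearP.
have vsvalP a (u v : h3 R) : vsval (a *: u + v) = a *: vsval u + vsval v.
  by rewrite linearP.
split=> [w|w] a u v; rewrite /bracket; cbn beta; rewrite vsprojP vsvalP;
  congr (vsproj _ _);
  by rewrite mulmxDl mulmxDr -scalemxAl -scalemxAr scalerBr opprD addrACA.
Qed.

HB.instance Definition _ := bilinear_isBilinear.Build R (h3 R) (h3 R) (h3 R)
  _ _ (@bracket R) bracket_is_bilinear.

Lemma bracketC u v : bracket u v = - bracket v u.
Proof. by rewrite /bracket -[X in vsproj _ X]opprB linearN. Qed.

Lemma bracketvv u : bracket u u = 0.
Proof. by rewrite /bracket subrr linear0. Qed.

End Bracket.

(** * Automorphisms of the Heisenberg algebra *)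

Section HeisenbergBasis.
Variables (R : realType) (X : 3.-tuple (h3 R)).
Hypothesis X_basis : basis_of fullv X.
Hypothesis X12 : bracket (tnth X 0) (tnth X 1) = tnth X 2%:R.
Hypothesis X13 : bracket (tnth X 0) (tnth X 2%:R) = 0.
Hypothesis X23 : bracket (tnth X 1) (tnth X 2%:R) = 0.
Implicit Types u v w y z : h3 R.
Local Notation omega := (coord X).

Lemma omega_expand u :
  u = omega 0 u *: tnth X 0 + omega 1 u *: tnth X 1
      + omega 2%:R u *: tnth X 2%:R.
Proof.
rewrite {1}(coord_basis X_basis (memvf u)) !big_ord_recl big_ord0 addr0 addrA.
rewrite -!tnth_nth.
have -> : lift ord0 ord0 = 1 :> 'I_3 by apply: val_inj.
by have -> : lift ord0 (lift ord0 ord0) = 2%:R :> 'I_3 by apply: val_inj.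
Qed.

Lemma omega_tnth (i j : 'I_3) : omega i (tnth X j) = (i == j)%:R.
Proof.
by rewrite (tnth_nth 0) coord_free ?(basis_free X_basis) // eq_sym.
Qed.

Lemma bracket_omega u v :
  bracket u v = (omega 0 u * omega 1 v - omega 1 u * omega 0 v) *: tnth X 2%:R.
Proof.
rewrite {1}[u]omega_expand {1}[v]omega_expand.
rewrite !linearDl !linearDr !linearZl_LR !linearZr_LR /=.
rewrite !bracketvv X12 X13 X23.
rewrite [bracket (tnth X 1) (tnth X 0)]bracketC.
rewrite [bracket (tnth X 2%:R) (tnth X 0)]bracketC.
rewrite [bracket (tnth X 2%:R) (tnth X 1)]bracketC X12 X13 X23.
by rewrite !(scaler0, oppr0, addr0, add0r) !scalerN !scalerA -scaleNr -scalerDl.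
Qed.

Lemma bracket_central u v w : bracket u (bracket v w) = 0.
Proof.
rewrite (bracket_omega v) linearZr_LR /= bracket_omega !omega_tnth /=.
by rewrite !mulr0 subr0 scale0r scaler0.
Qed.

(** The third image [y, z] is central, whatever y and z are, so the relations of
the basis X are preserved.  For injectivity, bracketing phi u with z and y
recovers the first two coordinates of u as multiples of [y, z]. *)
Lemma automorphism_of_pair y z : bracket y z != 0 ->
  exists2 phi : 'End(h3 R), lie_automorphism phi &
    forall u, phi u =
      omega 0 u *: y + omega 1 u *: z + omega 2%:R u *: bracket y z.
Proof.
move=> yz_neq0.
pose f u := omega 0 u *: y + omega 1 u *: z + omega 2%:R u *: bracket y z.
have f_linear : linear f.
  move=> a u v; rewrite /f !linearP /= !scalerDl !scalerDr !scalerA.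
  by rewrite [RHS]addrACA [in RHS](addrACA (_ *: y)).
pose fL := GRing.isLinear.Build _ _ _ _ f f_linear.
pose F : {linear h3 R -> h3 R} := HB.pack f fL.
have phiE u : linfun F u = f u by rewrite lfunE.
have fy u : bracket (f u) y = (- omega 1 u) *: bracket y z.
  rewrite /f !linearDl !linearZl_LR /= bracketvv.
  rewrite [bracket (bracket y z) y]bracketC bracket_central.
  by rewrite oppr0 !scaler0 add0r addr0 [bracket z y]bracketC scalerN scaleNr.
have fz u : bracket (f u) z = omega 0 u *: bracket y z.
  rewrite /f !linearDl !linearZl_LR /= bracketvv.
  rewrite [bracket (bracket y z) z]bracketC bracket_central.
  by rewrite oppr0 !scaler0 !addr0.
exists (linfun F) => //; split.
  have f0 u : f u = 0 -> u = 0.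
    move=> fu0.
    have u0 : omega 0 u = 0.
      have /eqP := fz u; rewrite fu0 linear0l eq_sym scaler_eq0.
      by rewrite (negPf yz_neq0) orbF => /eqP.
    have u1 : omega 1 u = 0.
      have /eqP := fy u; rewrite fu0 linear0l eq_sym scaler_eq0 oppr_eq0.
      by rewrite (negPf yz_neq0) orbF => /eqP.
    move/eqP: fu0; rewrite /f u0 u1 !scale0r !add0r scaler_eq0.
    rewrite (negPf yz_neq0) orbF => /eqP u2.
    by rewrite [u]omega_expand u0 u1 u2 !scale0r !addr0.
  have f_ker : lker (linfun F) == 0%VS.
    rewrite -subv0; apply/subvP=> u; rewrite memv_ker memv0 phiE => /eqP.
    by move/f0 => ->.
  exists (linfun F)^-1%VF; [exact: lker0_lfunK | exact: lker0_lfunVK].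
move=> u v; rewrite !phiE [in RHS]/f !linearDr !linearZr_LR /= fy fz.
rewrite bracket_central scaler0 addr0 !scalerA -scalerDl.
have omegaX3 i a : omega i (a *: tnth X 2%:R) = a * (i == 2%:R)%:R.
  by rewrite linearZ /= omega_tnth.
rewrite bracket_omega /f !omegaX3 /= !mulr0 !scale0r !add0r mulr1.
by congr (_ *: _); ring.
Qed.

End HeisenbergBasis.

(** * Homogeneous vectors of the grading *)

Section Grading.
Variables (R : realType) (G : Z22 -> {vspace h3 R}).
Hypothesis G_structure : Z22_symmetric_structure G.
Implicit Types (c d s t : Z22) (u v : h3 R).

Lemma Z22P (P : Z22 -> Prop) :
  P (0, 0) -> P (0, 1) -> P (1, 0) -> P (1, 1) -> forall c, P c.
Proof.
have Z2P (a : 'Z_2) : a = 0 \/ a = 1.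
  by case: a => [[|[|a]] lt_a] //; [left | right]; apply: val_inj.
by move=> P00 P01 P10 P11 [a b]; case: (Z2P a) => ->; case: (Z2P b) => ->.
Qed.

Lemma addZ22 c : c + c = 0.
Proof. by elim/Z22P: c; apply/eqP. Qed.

Lemma Z22_charDl c d s : Z22_char R (c + d) s = Z22_char R c s * Z22_char R d s.
Proof.
rewrite /Z22_char -exprD -signr_odd -[RHS]signr_odd; congr (_ ^+ nat_of_bool _).
by elim/Z22P: c; elim/Z22P: d; elim/Z22P: s.
Qed.

Lemma Z22_charC c s : Z22_char R c s = Z22_char R s c.
Proof.
by rewrite /Z22_char ![(nat_of_ord s.1 * _)%N]mulnC
  ![(nat_of_ord s.2 * _)%N]mulnC.
Qed.

Lemma Z22_charDr c s t : Z22_char R c (s + t) = Z22_char R c s * Z22_char R c t.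
Proof. by rewrite !(Z22_charC c) Z22_charDl. Qed.

(** Orthogonality of the characters of Z_2^2, which makes the averages
(1/4) sum_s chi_c(s) sigma_s add up to the identity. *)
Lemma sum_Z22_char s : \sum_c Z22_char R c s = if s == 0 then 4%:R else 0.
Proof.
rewrite -(pair_bigA _ (fun a b => Z22_char R (a, b) s)) /=.
rewrite !big_ord_recl !big_ord0 /Z22_char.
by elim/Z22P: s => /=; rewrite ?expr0 ?expr1; lra.
Qed.

Lemma mem_component (sigma : Z22 -> 'End(h3 R)) c u :
    (forall c, G c =
       (\bigcap_s passmx.leigenspace (sigma s) (Z22_char R c s))%VS) ->
   reflect (forall s, sigma s u = Z22_char R c s *: u) (u \in G c).
Proof.
move=> ->; rewrite memvE; apply: (iffP subv_bigcapP) => [u_eig s|u_eig s _].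
  have := u_eig s isT; rewrite -memvE memv_ker add_lfunE opp_lfunE scale_lfunE.
  by rewrite id_lfunE subr_eq0 => /eqP.
rewrite -memvE memv_ker add_lfunE opp_lfunE.
by rewrite scale_lfunE id_lfunE u_eig subrr.
Qed.

Lemma component_bracket c d u v :
  u \in G c -> v \in G d -> bracket u v \in G (c + d).
Proof.
have [sigma [sigma_aut _ _ GE _]] := G_structure.
move=> /(mem_component _ _ GE) u_c /(mem_component _ _ GE) v_d.
apply/(mem_component _ _ GE) => s.
have [_ ->] := sigma_aut s; rewrite u_c v_d linearZl_LR linearZr_LR /= scalerA.
by rewrite Z22_charDl.
Qed.

Lemma component_decomposition u :
  exists2 p : Z22 -> h3 R, (forall c, p c \in G c) & u = \sum_c p c.
Proof.
have [sigma [sigma_aut sigmaD _ GE _]] := G_structure.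
have sigma0 v : sigma 0 v = v.
  have [/bij_inj sigma0_inj _] := sigma_aut 0; apply: sigma0_inj.
  by rewrite -comp_lfunE -sigmaD addr0.
exists (fun c => 4%:R^-1 *: \sum_s Z22_char R c s *: sigma s u) => [c|].
  apply/(mem_component _ _ GE) => t; rewrite linearZ scalerA mulrC -scalerA /=.
  congr (_ *: _); rewrite linear_sum scaler_sumr /=.
  rewrite [RHS](reindex_inj (addrI t)) /=; apply: eq_bigr => s _.
  rewrite linearZ /= -comp_lfunE -sigmaD scalerA -Z22_charDr addrA addZ22.
  by rewrite add0r.
rewrite -scaler_sumr exchange_big /= (bigD1 (0 : Z22)) //= -scaler_suml.
rewrite sum_Z22_char eqxx sigma0 big1 ?addr0 => [|s s_neq0].
  by rewrite scalerA mulVf ?scale1r ?pnatr_eq0.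
by rewrite -scaler_suml sum_Z22_char (negPf s_neq0) scale0r.
Qed.

(** Expand [u, v] along the homogeneous parts of u and v: one term is nonzero.
Its three degrees c, d, c + d are nonzero because the component of degree 0
vanishes, and c = d would give c + d = 0. *)
Lemma component_pair u v : bracket u v != 0 ->
  exists c d, [/\ c != 0, d != 0, c != d & c + d != 0] /\
  exists y z, [/\ y \in G c, z \in G d & bracket y z != 0].
Proof.
have [p p_G ->] := component_decomposition u.
have [q q_G ->] := component_decomposition v.
have G0 : G 0 = 0%VS by have [? []] := G_structure.
move=> pq_neq0.
have /existsP[c /existsP[d pq_cd]] :
    [exists c, exists d, bracket (p c) (q d) != 0].
  apply: contraNT pq_neq0 => /existsPn pq0; rewrite linear_sumlz big1 // => c _.
  rewrite linear_sumr big1 // => d _.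
  by have /existsPn/(_ d)/negbNE/eqP := pq0 c.
have cd_neq0 : c + d != 0.
  apply: contraNneq pq_cd => cd0; rewrite -memv0 -G0 -cd0.
  exact: component_bracket.
exists c, d; split; last by exists (p c), (q d).
split=> //.
- apply: contraNneq pq_cd => c0; have := p_G c.
  by rewrite c0 G0 memv0 => /eqP ->; rewrite linear0l.
- apply: contraNneq pq_cd => d0; have := q_G d.
  by rewrite d0 G0 memv0 => /eqP ->; rewrite linear0r.
- by apply: contraNneq cd_neq0 => ->; rewrite addZ22.
Qed.

End Grading.

(** * Signs of a diagonal Lorentzian form *)

(** Here w is timelike and its orthogonal complement is positive definite.  Some
a i is negative because of w.  If a j <= 0 for another j, then the plane of
coordinates i and j contains a nonzero vector orthogonal to w, on which the form
is not positive. *)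
Lemma diagonal_signs (R : realType) n (a w : 'I_n -> R) :
  \sum_i a i * w i ^+ 2 < 0 ->
  (forall u : 'I_n -> R, (exists i, u i != 0) ->
     \sum_i a i * (u i * w i) = 0 -> 0 < \sum_i a i * u i ^+ 2) ->
  exists i, a i < 0 /\ forall j, j != i -> 0 < a j.
Proof.
move=> w_time pos.
have /existsP[i aiw] : [exists i, a i * w i ^+ 2 < 0].
  apply: contraLR w_time => /existsPn aw; rewrite -leNgt sumr_ge0 // => i _.
  by rewrite leNgt aw.
have wi2_gt0 : 0 < w i ^+ 2.
  rewrite lt0r sqr_ge0 andbT.
  by apply: contraTneq aiw => ->; rewrite mulr0 ltxx.
have ai_lt0 : a i < 0 by move: aiw; rewrite pmulr_llt0.
exists i; split=> // j jDi; rewrite ltNge; apply/negP => aj_le0.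
(* The combination of the basis vectors i and j that is orthogonal to w. *)
pose u k := if k == i then - (a j * w j) else if k == j then a i * w i else 0.
have sum2 (F : 'I_n -> R) : (forall k, k != i -> k != j -> F k = 0) ->
    \sum_k F k = F i + F j.
  move=> F0; rewrite (bigD1 i) //= (bigD1 j) //= big1 ?addr0 // => k.
  by case/andP; apply: F0.
have u_i : u i = - (a j * w j) by rewrite /u eqxx.
have u_j : u j = a i * w i by rewrite /u (negPf jDi) eqxx.
have u_k k : k != i -> k != j -> u k = 0 by rewrite /u => /negPf-> /negPf->.
have : 0 < \sum_k a k * u k ^+ 2.
  apply: pos.
    exists j; rewrite u_j mulf_neq0 ?(lt_eqF ai_lt0) //.
    by apply: contraTneq wi2_gt0 => ->; rewrite expr0n ltxx.
  rewrite sum2 ?u_i ?u_j => [|k ki kj]; first by ring.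
  by rewrite u_k // mul0r mulr0.
rewrite sum2 ?u_i ?u_j => [|k ki kj]; last by rewrite u_k // expr0n mulr0.
have -> : a i * (- (a j * w j)) ^+ 2 + a j * (a i * w i) ^+ 2
  = a j * (a i ^+ 2 * w i ^+ 2) + a i * (a j ^+ 2 * w j ^+ 2) by ring.
apply/negP; rewrite -leNgt.
have := mulr_ge0 (sqr_ge0 (a i)) (ltW wi2_gt0).
have := mulr_ge0 (sqr_ge0 (a j)) (sqr_ge0 (w j)).
move=> P Q; rewrite -[leRHS]addr0 lerD ?mulr_le0_ge0 //.
exact: ltW.
Qed.

(** * Lorentzian forms on the Heisenberg algebra *)

Section LorentzianForm.
Variables (R : realType) (B : {symmetric (h3 R)}).
Implicit Types u v w y z : h3 R.

Lemma symmetric_formC u v : B u v = B v u.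
Proof. by rewrite hermC expr0 mul1r. Qed.

Lemma symmetric_formDl u v w : B (u + v) w = B u w + B v w.
Proof. exact: linearDl. Qed.

Lemma symmetric_formDr u v w : B w (u + v) = B w u + B w v.
Proof. exact: linearDr. Qed.

Lemma symmetric_formZl a u w : B (a *: u) w = a * B u w.
Proof. exact: linearZl_LR. Qed.

Lemma symmetric_formZr a u w : B w (a *: u) = a * B w u.
Proof. exact: linearZr_LR. Qed.

(** The third vector of a basis in which B is diag(1, 1, -1). *)
Lemma timelike_vector : has_signature_on B fullv 2 1 ->
  exists2 w, B w w < 0 & forall u, u != 0 -> B u w = 0 -> 0 < B u u.
Proof.
case=> e e_basis Be.
pose c i u := coord e i u.
have eE u : u = \sum_i c i u *: tnth e i.
  rewrite {1}(coord_basis e_basis (memvf u)); apply: eq_bigr => i _.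
  by rewrite (tnth_nth 0).
have BuE u i : B u (tnth e i) = c i u * (-1) ^+ (2 <= i)%N.
  rewrite {1}[u]eE linear_sumlz (bigD1 i) //= big1 => [|j /negPf ji].
    by rewrite symmetric_formZl Be eqxx addr0.
  by rewrite symmetric_formZl Be ji mulr0.
exists (tnth e ord_max); first by rewrite Be eqxx expr1 oppr_lt0 ltr01.
move=> u u_neq0; rewrite BuE /= expr1 mulrN1 => /eqP.
rewrite oppr_eq0 => /eqP c2.
have BuuE : B u u = \sum_i c i u ^+ 2 * (-1) ^+ (2 <= i)%N.
  rewrite {2}[u]eE linear_sumr /=; apply: eq_bigr => i _.
  by rewrite symmetric_formZr BuE mulrA.
rewrite BuuE big_ord_recr /= c2 expr0n mul0r addr0.
rewrite lt0r; apply/andP; split; last first.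
  by apply: sumr_ge0 => i _; rewrite leqNgt ltn_ord mulr1 sqr_ge0.
apply: contraNneq u_neq0 => /eqP; rewrite psumr_eq0; last first.
  by move=> i _; rewrite leqNgt ltn_ord mulr1 sqr_ge0.
move=> /allP c01; rewrite [u]eE big_ord_recr /= c2 scale0r addr0 big1 // => i _.
have := c01 i (mem_index_enum _); rewrite /= leqNgt ltn_ord mulr1 sqrf_eq0.
by move/eqP ->; rewrite scale0r.
Qed.

Variable X : 3.-tuple (h3 R).
Hypothesis X_basis : basis_of fullv X.
Hypothesis X12 : bracket (tnth X 0) (tnth X 1) = tnth X 2%:R.
Hypothesis X13 : bracket (tnth X 0) (tnth X 2%:R) = 0.
Hypothesis X23 : bracket (tnth X 1) (tnth X 2%:R) = 0.
Local Notation omega := (coord X).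

Lemma orthogonal_pair_pullback y z :
  bracket y z != 0 ->
  B y z = 0 -> B y (bracket y z) = 0 -> B z (bracket y z) = 0 ->
  exists2 phi : 'End(h3 R), lie_automorphism phi &
    forall u v, B (phi u) (phi v) =
      B y y * (omega 0 u * omega 0 v) + B z z * (omega 1 u * omega 1 v)
      + B (bracket y z) (bracket y z) * (omega 2%:R u * omega 2%:R v).
Proof.
move=> yz_neq0 Byz Byb Bzb.
have [phi phi_aut phiE] := automorphism_of_pair X_basis X12 X13 X23 yz_neq0.
exists phi => // u v; rewrite !phiE.
rewrite !(symmetric_formDl, symmetric_formDr).
rewrite !(symmetric_formZl, symmetric_formZr).
rewrite (symmetric_formC z y) !(symmetric_formC (bracket y z) y).
rewrite (symmetric_formC (bracket y z) z) Byz Byb Bzb; ring.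
Qed.

Lemma orthogonal_pair_signs y z :
  has_signature_on B fullv 2 1 -> bracket y z != 0 ->
  B y z = 0 -> B y (bracket y z) = 0 -> B z (bracket y z) = 0 ->
  [\/ [/\ B y y < 0, 0 < B z z & 0 < B (bracket y z) (bracket y z)],
      [/\ 0 < B y y, B z z < 0 & 0 < B (bracket y z) (bracket y z)]
    | [/\ 0 < B y y, 0 < B z z & B (bracket y z) (bracket y z) < 0]].
Proof.
move=> /timelike_vector[w w_time w_pos] yz_neq0 Byz Byb Bzb.
have [phi [[psi phiK psiK] _] BphiE] :=
  orthogonal_pair_pullback yz_neq0 Byz Byb Bzb.
pose a (i : 'I_3) := [:: B y y; B z z; B (bracket y z) (bracket y z)]`_i.
have sum3 (F : 'I_3 -> R) : \sum_i F i = F 0 + F 1 + F 2%:R.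
  rewrite !big_ord_recl big_ord0 addr0 addrA; congr (_ + F _ + F _);
  exact: val_inj.
have [] := @diagonal_signs R 3 a (fun i => omega i (psi w)).
- by move: w_time; rewrite -{1 2}[w]psiK BphiE sum3 -!expr2.
- move=> u [i ui]; pose x := \sum_j u j *: tnth X j.
  have ux j : omega j x = u j.
    rewrite linear_sum (bigD1 j) //= big1 => [|k /negPf kj].
      by rewrite linearZ /= omega_tnth // eqxx mulr1 addr0.
    by rewrite linearZ /= omega_tnth // eq_sym kj mulr0.
  have := w_pos (phi x); rewrite -{1}[w]psiK !BphiE !sum3 !ux -!expr2.
  move=> pos uw; apply: pos => //.
  apply: contraNneq ui => phix0; rewrite -ux -[x]phiK phix0.
  by rewrite -(linear0 phi) phiK linear0.
move=> i [ai_lt0 aj_gt0].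
have a0 : a 0 = B y y by [].
have a1 : a 1 = B z z by [].
have a2 : a 2%:R = B (bracket y z) (bracket y z) by [].
case: i ai_lt0 aj_gt0 => [[|[|[|]]] lt_i] // ai_lt0 aj_gt0.
- constructor 1; rewrite -a0 -a1 -a2; split; try exact: aj_gt0.
  by rewrite (_ : 0 = Ordinal lt_i) //; apply: val_inj.
- constructor 2; rewrite -a0 -a1 -a2; split; try exact: aj_gt0.
  by rewrite (_ : 1 = Ordinal lt_i) //; apply: val_inj.
- constructor 3; rewrite -a0 -a1 -a2; split; try exact: aj_gt0.
  by rewrite (_ : 2%:R = Ordinal lt_i) //; apply: val_inj.
Qed.

(** Scaling y and z by p and q scales [y, z] by p q, so the first two
coefficients can be normalized, and this fixes the scale of the third. *)
Lemma normalized_pair_pullback y z :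
  bracket y z != 0 ->
  B y z = 0 -> B y (bracket y z) = 0 -> B z (bracket y z) = 0 ->
  B y y != 0 -> B z z != 0 -> B (bracket y z) (bracket y z) != 0 ->
  exists2 phi : 'End(h3 R), lie_automorphism phi &
    exists2 lambda : R, lambda != 0 &
    forall u v, B (phi u) (phi v) =
      Num.sg (B y y) * (omega 0 u * omega 0 v)
      + Num.sg (B z z) * (omega 1 u * omega 1 v)
      + Num.sg (B (bracket y z) (bracket y z)) * lambda ^+ 2
        * (omega 2%:R u * omega 2%:R v).
Proof.
set b := bracket y z => b_neq0 Byz Byb Bzb Byy Bzz Bbb.
pose r (t : R) := Num.sqrt `|t|.
have r_neq0 t : t != 0 -> r t != 0.
  by move=> t0; rewrite sqrtr_eq0 -ltNge normr_gt0.
have sgE t : t != 0 -> t = Num.sg t * r t ^+ 2.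
  by move=> t0; rewrite sqr_sqrtr // -numEsg.
pose p := (r (B y y))^-1; pose q := (r (B z z))^-1.
have bE : bracket (p *: y) (q *: z) = (p * q) *: b.
  by rewrite linearZl_LR linearZr_LR /= scalerA.
have p_neq0 : p != 0 by rewrite invr_eq0 r_neq0.
have q_neq0 : q != 0 by rewrite invr_eq0 r_neq0.
have [||||phi phi_aut BphiE] := @orthogonal_pair_pullback (p *: y) (q *: z).
- by rewrite bE scaler_eq0 mulf_eq0 (negPf p_neq0) (negPf q_neq0).
- by rewrite symmetric_formZl symmetric_formZr Byz !mulr0.
- by rewrite bE symmetric_formZl symmetric_formZr Byb !mulr0.
- by rewrite bE symmetric_formZl symmetric_formZr Bzb !mulr0.
exists phi => //; exists (p * q * r (B b b)).
  by rewrite !mulf_neq0 ?r_neq0.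
move=> u v; rewrite BphiE bE !symmetric_formZl !symmetric_formZr.
have py : p * (p * B y y) = Num.sg (B y y).
  by rewrite {1}[B y y]sgE // /p; field; rewrite r_neq0.
have qz : q * (q * B z z) = Num.sg (B z z).
  by rewrite {1}[B z z]sgE // /q; field; rewrite r_neq0.
rewrite py qz {1}[B b b]sgE //; ring.
Qed.

End LorentzianForm.

Theorem proposition21 (R : realType) (X : 3.-tuple (h3 R))
    (X_basis : basis_of fullv X)
    (X12 : bracket (tnth X 0) (tnth X 1) = tnth X 2%:R)
    (X13 : bracket (tnth X 0) (tnth X 2%:R) = 0)
    (X23 : bracket (tnth X 1) (tnth X 2%:R) = 0)
    (G : Z22 -> {vspace h3 R}) (G_structure : Z22_symmetric_structure G)
    (g : 'M[R]_3 -> {symmetric (h3 R)})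
    (g_metric : Z22_symmetric_lorentzian_metric G g)
    (G_nondegenerate : forall c, c != 0 -> nondegenerate_on (g 1%:M) (G c)) :
  let omega (i : 'I_3) (u : h3 R) : R := coord X i u in
  exists phi : 'End(h3 R), lie_automorphism phi /\
  exists lambda : R, lambda != 0 /\
    ((forall u v : h3 R, g 1%:M (phi u) (phi v) =
        - (omega 0 u * omega 0 v) + omega 1 u * omega 1 v
        + lambda ^+ 2 * (omega 2%:R u * omega 2%:R v))
     \/
     (forall u v : h3 R, g 1%:M (phi u) (phi v) =
        omega 0 u * omega 0 v + omega 1 u * omega 1 v
        - lambda ^+ 2 * (omega 2%:R u * omega 2%:R v))).
Proof.
have [[_ g_signature] _ g_form] := g_metric.
have B_lorentz : has_signature_on (g 1%:M) fullv 2 1.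
  apply: g_signature; apply/forallP => i; apply/forallP => j.
  by apply/implyP => _; rewrite mxE.
move: (g 1%:M) G_nondegenerate g_form B_lorentz => B B_nondeg B_form B_lorentz.
have B_orth c d : c != 0 -> d != 0 -> c != d -> orthogonal_spaces B (G c) (G d).
  case: B_form => [[_]|[l0 l0_neq0 [l0_deg]]]; first exact.
  by case: l0_deg; exact: B_nondeg.
have X3_neq0 : bracket (tnth X 0) (tnth X 1) != 0.
  rewrite X12; apply: contraTneq (basis_free X_basis) => X3_eq0.
  by apply/negP => /free_not0 /(_ (mem_tnth 2%:R X)); rewrite X3_eq0 eqxx.
have [c [d [[c0 d0 cd cd0] [y [z [y_c z_d yz_neq0]]]]]] :=
  component_pair G_structure X3_neq0.
have b_cd := component_bracket G_structure y_c z_d.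
have Byz : B y z = 0 by apply: B_orth y_c z_d.
have Byb : B y (bracket y z) = 0.
  apply: B_orth y_c b_cd => //; apply: contraNneq d0 => e.
  by rewrite -[d]add0r -(addZ22 c) -addrA -e addZ22.
have Bzb : B z (bracket y z) = 0.
  apply: B_orth z_d b_cd => //; apply: contraNneq c0 => e.
  by rewrite -[c]addr0 -(addZ22 d) addrA -e addZ22.
have pullback := normalized_pair_pullback X_basis X12 X13 X23.
case: (orthogonal_pair_signs X_basis X12 X13 X23 B_lorentz yz_neq0 Byz Byb Bzb).
- case=> By Bz Bb.
  have [phi phi_aut [lambda lambda_neq0 BphiE]] :=
    pullback B y z yz_neq0 Byz Byb Bzb
      (ltr0_neq0 By) (lt0r_neq0 Bz) (lt0r_neq0 Bb).
  exists phi; split=> //; exists lambda; split=> //; left=> u v.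
  by rewrite BphiE ltr0_sg // !gtr0_sg // mulN1r !mul1r.
- case=> By Bz Bb.
  (* Exchanging y and z only changes the sign of their bracket. *)
  have bC : bracket z y = - bracket y z by rewrite bracketC.
  have bb : B (- bracket y z) (- bracket y z) = B (bracket y z) (bracket y z).
    by rewrite linearNr linearNl opprK.
  have [|||||||phi phi_aut [lambda lambda_neq0 BphiE]] := pullback B z y.
  - by rewrite bC oppr_eq0.
  - by rewrite symmetric_formC.
  - by rewrite bC linearNr /= Bzb oppr0.
  - by rewrite bC linearNr /= Byb oppr0.
  - exact: ltr0_neq0.
  - exact: lt0r_neq0.
  - by rewrite bC bb lt0r_neq0.
  exists phi; split=> //; exists lambda; split=> //; left=> u v.
  rewrite BphiE bC bb ltr0_sg // !gtr0_sg //.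
  by rewrite mulN1r !mul1r.
- case=> By Bz Bb.
  have [phi phi_aut [lambda lambda_neq0 BphiE]] :=
    pullback B y z yz_neq0 Byz Byb Bzb
      (lt0r_neq0 By) (lt0r_neq0 Bz) (ltr0_neq0 Bb).
  exists phi; split=> //; exists lambda; split=> //; right=> u v.
  by rewrite BphiE (gtr0_sg By) (gtr0_sg Bz) (ltr0_sg Bb) mulN1r !mul1r mulNr.
Qed.
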